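(* For $n\ge1$, $$\sum_{\pi\in\mathrm{PPF}(n)}x^{\mathrm{unl}(\pi)}y^{\mathrm{rep}(\pi)}=\prod_{i=1}^{n-1}\big(xy+(i-1)x+n-1-i\big).$$
   Context: A parking function of length $n$ is a sequence $\pi=(\pi_1,\dots,\pi_n)$ of positive integers whose increasing rearrangement $b_1\le\dots\le b_n$ satisfies $b_i\le i$. It is prime if for every $1\le j\le n-1$ at least $j+1$ of the entries are $\le j$; $\mathrm{PPF}(n)$ is the set of prime parking functions of length $n$. Under the classical protocol (cars $1,\dots,n$ arrive in order, car $i$ parks in the first unoccupied spot among $\pi_i,\pi_i+1,\dots,n$), $\mathrm{unl}(\pi)$ is the number of cars not parking at their preferred spot. $\mathrm{rep}(\pi)=\#\{2\le i\le n:\pi_i=\pi_{i-1}\}$. *)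

(* Defs.v *)
From HB Require Import structures.
From mathcomp Require Import all_boot all_order all_algebra.

Set Implicit Arguments.
Unset Strict Implicit.
Unset Printing Implicit Defensive.

(* Sequences are stored in [seq nat] with 0-based positions, while their
   entries are the 1-based spots; hence the bound [i.+1] on the entry at
   position [i] of the increasing rearrangement. *)
Definition parking_function (s : seq nat) : bool :=
  all (leq 1) s &&
  [forall i : 'I_(size s), nth 0 (sort leq s) i <= i.+1].

Definition prime_parking_function (s : seq nat) : bool :=
  parking_function s &&
  all (fun j => j.+1 <= count (fun a => a <= j) s) (iota 1 (size s).-1).

(* The spot taken by a car preferring [p] on a street with spots 1, ..., n
   when the spots in [occ] are occupied; [None] if the car cannot park. *)
Definition first_free (n : nat) (occ : seq nat) (p : nat) : option nat :=
  ohead [seq q <- iota p (n.+1 - p) | q \notin occ].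

Fixpoint park_from (n : nat) (occ s : seq nat) : seq (option nat) :=
  if s is p :: s' then
    let q := first_free n occ p in
    q :: park_from n (if q is Some r then r :: occ else occ) s'
  else [::].

Definition outcome (s : seq nat) : seq (option nat) := park_from (size s) [::] s.

Definition unl (s : seq nat) : nat :=
  count (fun pq => pq.2 != Some pq.1) (zip s (outcome s)).

Definition rep (s : seq nat) : nat :=
  count (fun i => nth 0 s i == nth 0 s i.-1) (iota 1 (size s).-1).

Definition entries (n : nat) (t : n.-tuple 'I_n.+1) : seq nat :=
  [seq val i | i <- t].

(* Entries of a parking function of length n are at most n, so ranging over
   tuples with entries in {0, ..., n} loses nothing; see [PPFP]. *)
Definition PPF (n : nat) : {set n.-tuple 'I_n.+1} :=
  [set t | prime_parking_function (entries t)].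

Lemma parking_function_le (s : seq nat) :
  parking_function s -> all (fun a => a <= size s) s.
Proof.
case/andP=> _ /forallP H; apply/allP=> a.
rewrite -(mem_sort leq) => /(nthP 0) [i]; rewrite size_sort => lti <-.
exact: leq_trans (H (Ordinal lti)) lti.
Qed.

Lemma entries_inj (n : nat) : injective (@entries n).
Proof. by move=> t u /(inj_map val_inj) /val_inj. Qed.

Lemma PPFP (n : nat) (s : seq nat) :
  reflect (exists2 t, t \in PPF n & entries t = s)
          ((size s == n) && prime_parking_function s).
Proof.
apply: (iffP andP) => [[/eqP szs ps] | [t]]; last first.
  by rewrite inE => pt <-; rewrite size_map size_tuple.
have /allP les : all (fun a => a <= n) s.
  by rewrite -szs; apply: parking_function_le; case/andP: ps.
have szt : size [seq inord a : 'I_n.+1 | a <- s] == n by rewrite size_map szs.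
have et : entries (Tuple szt) = s.
  rewrite /entries /= -map_comp -[RHS]map_id; apply/eq_in_map => a /les lea.
  by rewrite /= inordK.
by exists (Tuple szt); rewrite // inE et.
Qed.

(* Main.v *)
Require Import Defs.
From HB Require Import structures.
From mathcomp Require Import all_boot all_order all_algebra.
From mathcomp Require Import zify.

(** Put [m = n - 1] spots on a circle and let [n] cars arrive one after the
    other. When [i] spots are taken, the next car repeats the previous
    preference (and is unlucky, as that spot is taken) in one way, is unlucky
    without repeating in [i - 1] ways, and is lucky in [m - i] ways. Fixing the
    first preference and letting [i] run from 1 to [m] gives the product.
    Unluckiness and repetitions are invariant under rotation, and by the cycle
    lemma exactly one rotation of each sequence is prime. Finally, on a prime
    parking function the linear and the circular protocols have the same unlucky
    cars, because only the last car parks at spot [n]. *)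

Set Implicit Arguments.
Unset Strict Implicit.
Unset Printing Implicit Defensive.

Import GRing.Theory.
Local Open Scope ring_scope.

(** * Counts in sorted sequences and free spots on the street *)

Lemma ltn_nth_sorted_count (b : seq nat) i v :
  sorted leq b -> (i < size b)%N -> (v < nth 0 b i)%N ->
  (count (fun a => a <= v) b <= i)%N.
Proof.
move=> sb lti ltv; rewrite -(cat_take_drop i b) count_cat.
rewrite [X in (_ + X)%N](_ : _ = 0%N) ?addn0.
  by rewrite (leq_trans (count_size _ _)) // size_take; case: ifP; lia.
apply/eqP; rewrite -leqn0 leqNgt -has_count; apply/hasPn => a /(nthP 0%N) [k].
rewrite size_drop nth_drop => ltk <-.
have : (nth 0 b i <= nth 0 b (i + k))%N.
  apply: (sorted_leq_nth leq_trans leqnn 0%N sb); rewrite ?inE ?leq_addr //.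
  by rewrite -ltn_subRL.
by move=> le; rewrite -ltnNge (leq_trans ltv).
Qed.

Lemma first_freeE n (L : seq nat) p q : (p <= q <= n)%N -> q \notin L ->
  (forall r, p <= r < q -> r \in L)%N -> first_free n L p = Some q.
Proof.
move=> /andP [pq qn] qN Lr; rewrite /first_free.
have -> : iota p (n.+1 - p) = iota p (q - p) ++ q :: iota q.+1 (n - q).
  rewrite -[_ :: _]/(iota q (n - q).+1) (_ : n.+1 - p = (q - p) + (n - q).+1)%N; last lia.
  by rewrite iotaD; congr (_ ++ iota _ _); lia.
rewrite filter_cat /= qN (_ : filter _ _ = [::]) //.
apply/eqP; rewrite -[_ == _]negbK -has_filter; apply/hasPn => r.
by rewrite mem_iota => lt; rewrite negbK Lr //; lia.
Qed.

Lemma first_free_eq n (L : seq nat) p : (p <= n)%N ->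
  (first_free n L p == Some p) = (p \notin L).
Proof.
move=> pn; have [pL|pN] := boolP (p \in L); last first.
  by rewrite (@first_freeE n L p p) ?eqxx ?leqnn // => r; lia.
apply/negP => /eqP; rewrite /first_free.
case E: [seq _ <- _ | _] => [|q f] //= [qp].
have : q \in [seq q <- iota p (n.+1 - p) | q \notin L] by rewrite E mem_head.
by rewrite mem_filter qp pL.
Qed.

Lemma first_gap (L : seq nat) p v :
  (exists q, [/\ p <= q <= v, q \notin L & forall r, p <= r < q -> r \in L])%N \/
  (forall r, p <= r <= v -> r \in L)%N.
Proof.
have [/hasP ex|/hasPn no] := boolP (has (fun q => q \notin L) (iota p (v.+1 - p))).
  have {}ex : exists q, (p <= q <= v)%N && (q \notin L).
    by case: ex => q; rewrite mem_iota => lt qN; exists q; rewrite qN andbT; lia.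
  case: (ex_minnP ex) => q /andP [pqv qN] qmin; left; exists q; split => // r ltr.
  by apply: contraT => rN; have := qmin r; rewrite rN andbT; lia.
right=> r ltr; apply: contraT => rN; suff /no/negP : r \in iota p (v.+1 - p) by [].
by rewrite mem_iota; lia.
Qed.

(** Spot [0] is a sentinel that is never taken: [v = 0] means that all positive spots below [p] are
    occupied. *)
Lemma last_gap (L : seq nat) p : (0 < p)%N -> 0%N \notin L ->
  exists v, [/\ v < p, v \notin L & forall r, v < r < p -> r \in L]%N.
Proof.
move=> p_gt0 L0; elim: p p_gt0 => // p IH _.
have [pL|pN] := boolP (p \in L); last by exists p; split => // r; lia.
have p_gt0 : (0 < p)%N by case: p pL {IH} => // pL; rewrite pL in L0.
have [v [ltv vN vL]] := IH p_gt0; exists v; split => // [|r ltr]; first lia.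
by have [->//|ne] := eqVneq r p; apply: vL; lia.
Qed.

(** * Parking on a circle and its invariance under rotation *)

Section Circle.
Variable m' : nat.
Local Notation m := m'.+1.
Implicit Types (occ : {set 'I_m}) (s : seq 'I_m) (p q c : 'I_m).

(* On a full circle [find] returns [m], so that the value is the junk spot [p]
   itself and [cpark] leaves the occupied set unchanged. *)
Definition cfree occ p : 'I_m :=
  p + inZp (find (fun k => p + inZp k \notin occ) (iota 0 m)).

Definition cpark occ p := cfree occ p |: occ.

Fixpoint cunl occ s : nat :=
  if s is p :: s' then ((p \in occ) + cunl (cpark occ p) s')%N else 0%N.

Fixpoint crep p s : nat :=
  if s is q :: s' then ((q == p) + crep q s')%N else 0%N.

(** The residue [a] stands for spot [a.+1], so [a < j] reads as a preference of at most [j]. *)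
Definition cprime s : bool :=
  all (fun j => j < count (fun a : 'I_m => a < j) s)%N (iota 1 m).

Lemma inZpK p : inZp p = p :> 'I_m.
Proof. by apply: val_inj; rewrite /= modn_small. Qed.

(** Lucky or not, a car leaves its preferred spot occupied; hence a car that repeats this preference
    is unlucky. *)
Lemma cpark_mem occ p : p \in cpark occ p.
Proof.
rewrite /cpark in_setU1; have [pL|pN] := boolP (p \in occ); first exact: orbT.
by rewrite orbF /cfree /= (inZpK 0) addr0 pN /= (inZpK 0) addr0.
Qed.

Lemma cfree_notin occ p : occ != setT -> cfree occ p \notin occ.
Proof.
rewrite -subTset => /subsetPn [q _ qN]; rewrite /cfree.
set P := (fun k => _).
have hP : has P (iota 0 m).
  apply/hasP; exists (val (q - p)); first by rewrite mem_iota add0n ltn_ord.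
  by rewrite /P inZpK addrC subrK.
have := nth_find 0%N hP; rewrite nth_iota ?add0n //.
by rewrite -[X in (_ < X)%N](size_iota 0 m) -has_find.
Qed.

(** The minimum covers the last of [m.+1] cars, which finds the circle full. *)
Lemma card_cpark occ p : #|cpark occ p| = minn #|occ|.+1 m.
Proof.
rewrite /cpark cardsU1; have [->|oN] := eqVneq occ setT.
  by rewrite !inE cardsT card_ord /=; lia.
have : (#|occ| < m)%N.
  by rewrite -[X in (_ < X)%N]card_ord -cardsT proper_card // properT.
by rewrite cfree_notin // add1n => lt; apply/esym/minn_idPl.
Qed.

Lemma mem_shift occ p c : (p + c \in [set a + c | a in occ]) = (p \in occ).
Proof. by apply: (mem_imset (f := +%R^~ c)) => u v /addIr. Qed.

Lemma cpark_shift occ p c :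
  cpark [set a + c | a in occ] (p + c) = [set a + c | a in cpark occ p].
Proof.
rewrite /cpark imsetU1; congr (_ |: _); rewrite /cfree.
rewrite -addrA [c + _]addrC addrA; congr (_ + inZp _ + c).
by apply: eq_find => k; rewrite -addrA [c + _]addrC addrA mem_shift.
Qed.

Lemma cunl_shift occ s c :
  cunl [set a + c | a in occ] [seq a + c | a <- s] = cunl occ s.
Proof.
elim: s occ => //= p s IH occ; rewrite cpark_shift IH; congr (_ + _)%N.
by rewrite mem_shift.
Qed.

Lemma crep_shift p s c : crep (p + c) [seq a + c | a <- s] = crep p s.
Proof. by elim: s p => //= q s IH p; rewrite IH (inj_eq (addIr c)). Qed.

(** Counterpart of [first_freeE]: a car that does not pass the origin parks as on the street. *)
Lemma cfreeE occ p q : (p <= q)%N -> q \notin occ ->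
  (forall r : 'I_m, p <= r < q -> r \in occ)%N -> cfree occ p = q.
Proof.
move=> pq qN occ_lt; rewrite /cfree.
have valE k : (p + k < m)%N -> (p + inZp k)%R = (p + k)%N :> nat.
  by move=> lt /=; rewrite modnDmr modn_small.
have ltq := ltn_ord q.
suff -> : find (fun k => p + inZp k \notin occ) (iota 0 m) = (q - p)%N.
  by apply: ord_inj; rewrite valE; lia.
have -> : iota 0 m = iota 0 (q - p) ++ (q - p)%N :: iota (q - p).+1 (m - (q - p).+1).
  by rewrite -[_ :: _]/(iota (q - p) (m - (q - p).+1).+1) -iotaD; congr iota; lia.
rewrite find_cat size_iota; case: ifP => [/hasP [k]|_].
  rewrite mem_iota => /andP [_ ltk] /negP []; apply: occ_lt.
  by rewrite valE; lia.
rewrite /= (_ : p + inZp (q - p) = q) ?qN ?addn0 //.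
by apply: ord_inj; rewrite valE; lia.
Qed.

(** * Rotated counts and the cycle lemma *)

Lemma subZpE p q : (p - q)%R = (if q <= p then p - q else p + m - q)%N :> nat.
Proof.
have := ltn_ord p; have := ltn_ord q => ltq ltp /=.
rewrite modnDmr; case: leqP => qp; last by rewrite modn_small; lia.
by rewrite (_ : p + (m - q) = (p - q) + m)%N ?modnDr ?modn_small; lia.
Qed.

(** The entries rotated below [j] come from the window [[q, q + j)], which does not wrap around
    here. *)
Lemma count_shift_low s q j : (q + j <= m)%N ->
  (count (fun a : 'I_m => a < j) [seq (a - q)%R | a <- s]
   + count (fun a : 'I_m => a < q) s
   = count (fun a : 'I_m => a < q + j) s)%N.
Proof.
move=> le; elim: s => //= a s IH; move: (subZpE a q) => /= ->.
have := ltn_ord a; move: IH; case: (leqP q a); lia.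
Qed.

(** Here the window wraps around and consists of [[q, m)] and [[0, q + j - m)]. *)
Lemma count_shift_high s q j : (m < q + j)%N -> (j <= m)%N ->
  (count (fun a : 'I_m => a < j) [seq (a - q)%R | a <- s]
   + count (fun a : 'I_m => a < q) s
   = size s + count (fun a : 'I_m => a < q + j - m) s)%N.
Proof.
move=> lt le; elim: s => //= a s IH; move: (subZpE a q) => /= ->.
have := ltn_ord a; have := ltn_ord q; move: IH; case: (leqP q a); lia.
Qed.

(* With [S i = N i - i], which gains 1 over a full turn, rotating [q] to the
   origin gives a prime sequence iff [q] is the last minimum of [S]. *)
Lemma cprime_shiftE s q : size s = m.+1 ->
  let N i := count (fun a : 'I_m => a < i)%N s in
  reflect (forall i : 'I_m, (N q + i + (q < i) <= N i + q)%N)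
    (cprime [seq a - q | a <- s]).
Proof.
move=> szs N.
have N0 : N 0%N = 0%N by rewrite /N (@eq_count _ _ pred0) ?count_pred0.
have Nm : N m = m.+1.
  by rewrite /N (@eq_count _ _ predT) ?count_predT // => a; rewrite ltn_ord.
have ltq := ltn_ord q.
apply: (iffP allP) => [H i | H j].
  have lti := ltn_ord i.
  have [lt|le] := ltnP q i.
    have /H : (i - q)%N \in iota 1 m by rewrite mem_iota; lia.
    have := @count_shift_low s q (i - q); rewrite (_ : q + (i - q) = i)%N; last lia.
    by rewrite -/(N q) -/(N i); lia.
  (* For [i = 0] the window ends exactly at [m], so it does not wrap and the full count [N m]
     enters. *)
  have [i0|i_gt0] := posnP i.
    have /H : (m - q)%N \in iota 1 m by rewrite mem_iota; lia.
    have := @count_shift_low s q (m - q); rewrite (_ : q + (m - q) = m)%N; last lia.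
    by rewrite -/(N q) -/(N m) i0 N0 Nm; lia.
  have /H : (i + m - q)%N \in iota 1 m by rewrite mem_iota; lia.
  have := @count_shift_high s q (i + m - q).
  rewrite (_ : q + (i + m - q) - m = i)%N; last lia.
  by rewrite -/(N q) -/(N i) szs; lia.
rewrite mem_iota => /andP [j_gt0 ltj].
have [lt|le] := ltnP m (q + j).
  have := @count_shift_high s q j lt.
  have := H (inord (q + j - m)); rewrite inordK; last lia.
  by rewrite -/(N q) -/(N (q + j - m)%N) szs; lia.
have := @count_shift_low s q j le; rewrite -/(N q) -/(N (q + j)%N).
have [e|ne] := eqVneq (q + j)%N m.
  have := H 0; rewrite /= N0 e Nm; lia.
have := H (inord (q + j)); rewrite inordK; lia.
Qed.

Lemma cycle_lemma s : size s = m.+1 ->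
  exists c, forall c', cprime [seq a + c' | a <- s] = (c' == c).
Proof.
move=> szs; pose N i := count (fun a : 'I_m => a < i)%N s.
(* The key is lexicographic: least [N i - i] first, then largest [i]. *)
have [q _ qmin] := @arg_minnP _ (0 : 'I_m) xpredT
  (fun i : 'I_m => ((N i + m - i) * m + (m - i))%N) isT.
have Pq : forall i : 'I_m, (N q + i + (q < i) <= N i + q)%N.
  move=> i; have := qmin i isT; have := ltn_ord i; have := ltn_ord q.
  case: ltnP; nia.
(* Adding [c'] moves position [- c'] to the origin. *)
exists (- q) => c'; rewrite -[c']opprK; move: (- c') => r.
rewrite (inj_eq oppr_inj).
apply/(cprime_shiftE r szs)/eqP => [Pr | -> //].
(* The two inequalities add up to [(r < q) + (q < r) <= 0]. *)
apply: val_inj; have := Pr q; have := Pq r; rewrite -/(N q) -/(N r) /=.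
by case: (ltngtP q r); lia.
Qed.

(** * From the circle to the street *)

Definition spots s : seq nat := [seq (val a).+1 | a <- s].

Lemma count_spots s v :
  count (fun a => a <= v)%N (spots s) = count (fun a : 'I_m => a < v)%N s.
Proof. by rewrite count_map; apply: eq_count. Qed.

(** The prime condition at [i.+1] bounds the sorted entry at each position [i < m]; the last one is
    at most [m] in any case. *)
Lemma prime_spots s : size s = m.+1 ->
  prime_parking_function (spots s) = cprime s.
Proof.
move=> szs; have szS : size (spots s) = m.+1 by rewrite size_map.
rewrite /prime_parking_function szS [m.+1.-1]/=.
have -> : all (fun j => j < count (fun a => a <= j) (spots s))%N (iota 1 m) = cprime s.
  by apply: eq_all => j; rewrite count_spots.
apply: andb_idl => /allP Ps; apply/andP; split; first by apply/allP => _ /mapP [a _ ->].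
apply/forallP => -[i lti] /=; rewrite szS in lti.
have szt : size (sort leq (spots s)) = m.+1 by rewrite size_sort.
rewrite leqNgt; apply/negP => lt_nth.
have := ltn_nth_sorted_count (sort_sorted leq_total _) _ lt_nth.
rewrite szt => /(_ lti); have /permP -> := permEl (perm_sort leq (spots s)).
rewrite count_spots; have [e|ne] := eqVneq i m; last first.
  have /Ps : i.+1 \in iota 1 m by rewrite mem_iota; lia.
  lia.
rewrite e (@eq_count _ _ predT) ?count_predT ?szs; first by lia.
by move=> a; rewrite /= (leq_trans (ltn_ord a)).
Qed.

Lemma rep_spots p s : rep (spots (p :: s)) = crep p s.
Proof.
rewrite /rep /= size_map; elim: s p => //= q s IH p.
rewrite eqSS -(IH q); congr (_ + _)%N.
by rewrite (iotaDl 1 1) count_map; apply: eq_in_count => i; rewrite mem_iota; case: i.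
Qed.

(* A car overflowing to spot [m.+1] comes after all of [v+1, ..., m] is filled
   for some free [v]; since cars parked beyond a free spot also preferred to
   park beyond it, too many cars prefer spots above [v] for a prime sequence,
   unless the overflowing car is the last one. *)
Lemma unl_cunl s1 s2 (L : seq nat) occ :
  size (s1 ++ s2) = m.+1 -> cprime (s1 ++ s2) ->
  (forall a : 'I_m, (a.+1 \in L) = (a \in occ)) -> 0%N \notin L ->
  (forall v, v \notin L ->
    count (fun a => v < a) L <= count (fun a => v < a) (spots s1))%N ->
  count (fun pq => pq.2 != Some pq.1)
    (zip (spots s2) (park_from m.+1 L (spots s2))) = cunl occ s2.
Proof.
elim: s2 s1 L occ => //= p s2 IH s1 L occ szs Ps Locc L0 Lcount.
have ltp := ltn_ord p.
rewrite first_free_eq ?negbK ?Locc; last lia.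
(* Where the present car parks matters only if another car follows. *)
congr (_ + _)%N; case: s2 IH szs Ps => // p2 s2 IH szs Ps.
have sz1 : (size s1 < m)%N by move: szs; rewrite size_cat /=; lia.
have [[q [pqm qN Lpq]]|full] := first_gap L p.+1 m.
  rewrite (@first_freeE m.+1 L p.+1 q) //; last lia.
  case: q => [|q] in pqm qN Lpq *; first lia.
  have ltq : (q < m)%N by lia.
  have qE : cfree occ p = Ordinal ltq.
    apply: cfreeE => /=; [lia | by rewrite -Locc | move=> r ltr].
    by rewrite -Locc Lpq //; lia.
  apply: (IH (rcons s1 p)); rewrite ?cat_rcons //.
    by move=> a; rewrite !inE qE Locc; congr (_ || _).
  move=> v; rewrite inE negb_or => /andP [vq vN].
  rewrite /spots map_rcons -cats1 count_cat /= addn0 addnC.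
  apply: leq_add; first exact: Lcount.
  (* A free [v] below the new spot [q.+1] is also below the preference [p.+1], as the spots from
     there up to [q.+1] are taken. *)
  have [lt|//] := ltnP v q.+1; have [//|le] := ltnP v p.+1.
  by rewrite Lpq in vN; lia.
exfalso.
have [v [ltv vN Lv]] := last_gap (ltn0Sn p) L0.
have cL : (m - v <= count (fun a => v < a) L)%N.
  rewrite -[X in (X <= _)%N](size_iota v.+1) -size_filter.
  apply: uniq_leq_size; first exact: iota_uniq.
  move=> r; rewrite mem_iota mem_filter => ltr; apply/andP; split; first lia.
  by have [le|lt] := leqP p.+1 r; [apply: full | apply: Lv]; lia.
have := Lcount v vN => cL1.
have c1 : count (fun a => v < a)%N (spots s1) = count (fun a : 'I_m => v <= a)%N s1.
  by rewrite count_map; apply: eq_count.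
have [v0|v_gt0] := posnP v; first by have := count_size (fun a : 'I_m => v <= a)%N s1; lia.
(* At least [v.+1] cars prefer spots up to [v], while at least [m - v] cars of [s1] and the present
   one prefer spots above [v]: more than [m.+1] in all. *)
have /(allP Ps) : v \in iota 1 m by rewrite mem_iota; lia.
have := count_predC (fun a : 'I_m => a < v)%N (s1 ++ [:: p, p2 & s2]).
rewrite szs (@eq_count _ (predC _) (fun a : 'I_m => v <= a)%N); last first.
  by move=> a /=; rewrite -leqNgt.
rewrite [X in (_ + X)%N]count_cat /=; lia.
Qed.

Lemma unl_spots s : size s = m.+1 -> cprime s -> unl (spots s) = cunl set0 s.
Proof.
move=> szs Ps; rewrite /unl /outcome size_map szs.
by apply: (@unl_cunl [::]) => // a; rewrite inE.
Qed.

End Circle.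

(** * The weighted sum over prime sequences on the circle *)

Lemma sum_tuple_cons (V : nmodType) (T : finType) k (F : seq T -> V) :
  \sum_(t : k.+1.-tuple T) F t = \sum_a \sum_(v : k.-tuple T) F (a :: v).
Proof.
rewrite pair_big (reindex (fun p : T * k.-tuple T => [tuple of p.1 :: p.2])) //=.
exists (fun t => (thead t, [tuple of behead t])) => [[a v]|t] _ /=.
  by congr (_, _); apply: val_inj.
by rewrite -tuple_eta.
Qed.

Section Weights.
Variables (R : comNzRingType) (x y : R) (m' : nat).
Local Notation m := m'.+1.
Implicit Types (occ : {set 'I_m}) (s : seq 'I_m).

Lemma sum_next_car occ (l : 'I_m) : l \in occ ->
  \sum_a x ^+ (a \in occ) * y ^+ (a == l)
    = x * y + (#|occ| - 1)%:R * x + (m - #|occ|)%:R.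
Proof.
move=> l_occ; rewrite (bigD1 l) //= l_occ eqxx !expr1 -addrA; congr (_ + _).
rewrite (bigID (fun a => a \in occ)) /=; congr (_ + _).
  rewrite (eq_bigr (fun=> x)) => [|a /andP [/negPf -> ->]]; last by rewrite mulr1.
  rewrite sumr_const mulr_natl; congr (_ *+ _).
  rewrite (cardsD1 l occ) l_occ addKn; apply: eq_card => a.
  by rewrite !inE.
rewrite (eq_bigr (fun=> 1)) => [|a /andP [/negPf -> /negPf ->]]; last by rewrite mulr1.
rewrite sumr_const; congr (_ *+ _).
rewrite -[X in (X - _)%N]card_ord -(cardsC occ) addKn; apply: eq_card => a.
by rewrite !inE unfold_in; case: (eqVneq a l) => [->|_] //; rewrite l_occ.
Qed.

(** Induction on the [k] cars still to come after [j] arrivals, [l] being the latest preference;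
    [minn j m] differs from [j] only when [k = 0]. *)
Lemma sum_cunl k j occ (l : 'I_m) :
  l \in occ -> #|occ| = minn j m -> (0 < j)%N -> (j + k = m.+1)%N ->
  \sum_(v : k.-tuple 'I_m) x ^+ cunl occ v * y ^+ crep l v =
  \prod_(j <= i < m.+1) (x * y + (i - 1)%:R * x + (m - i)%:R).
Proof.
elim: k j occ l => [|k IH] j occ l l_occ cocc j_gt0 jk.
  rewrite big_geq; last lia.
  by rewrite (big_pred1 [tuple]) /= ?mulr1 // => v; rewrite [v]tuple0 /= eqxx.
have jm : (j <= m)%N by lia.
rewrite (sum_tuple_cons _ (fun s => x ^+ cunl occ s * y ^+ crep l s)) big_ltn //=.
have occE : #|occ| = j by rewrite cocc; apply/minn_idPl; lia.
rewrite -occE -(sum_next_car l_occ) occE mulr_suml; apply: eq_bigr => a _.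
rewrite -(IH j.+1 (cpark occ a) a) ?cpark_mem ?card_cpark //; [|lia..].
by rewrite mulr_sumr; apply: eq_bigr => v _; rewrite !exprD mulrACA.
Qed.

Lemma sum_cprime :
  \sum_(t : m.+1.-tuple 'I_m | cprime t) x ^+ cunl set0 t * y ^+ rep (spots t) =
  \prod_(1 <= i < m.+1) (x * y + (i - 1)%:R * x + (m - i)%:R).
Proof.
pose w s := x ^+ cunl set0 s * y ^+ rep (spots s).
have w_shift a s : w [seq b + a | b <- 0 :: s] = x ^+ cunl [set 0] s * y ^+ crep 0 s.
  rewrite /w -{1}(imset0 (+%R^~ a)) cunl_shift rep_spots crep_shift /= in_set0 add0n.
  congr (x ^+ cunl _ _ * _); rewrite /cpark setU0; congr [set _].
  by apply: cfreeE => [||r]; rewrite ?in_set0 ?add0r //=; lia.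
rewrite big_mkcond (sum_tuple_cons _ (fun s => if cprime s then w s else 0)).
rewrite -(@sum_cunl m 1 [set 0] 0) ?set11 ?cards1 ?minnSS ?min0n //.
(* Each tuple is the rotation, by its first entry [a], of a tuple starting with [0]. The weight does
   not depend on [a], and exactly one [a] gives a prime tuple. *)
transitivity (\sum_a \sum_(v : m.-tuple 'I_m)
  if cprime [seq b + a | b <- 0 :: v] then w [seq b + a | b <- 0 :: v] else 0).
  apply: eq_bigr => a _.
  rewrite (reindex (fun v : m.-tuple 'I_m => [tuple of [seq b + a | b <- v]])) /=.
    by apply: eq_bigr => v _; rewrite add0r.
  exists (fun v : m.-tuple 'I_m => [tuple of [seq b - a | b <- v]]) => v _;
    apply: val_inj; rewrite /= -map_comp -[RHS]map_id; apply: eq_map => b /=.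
    by rewrite addrK.
  by rewrite subrK.
rewrite exchange_big; apply: eq_bigr => v _ /=.
have sz0v : size (0 :: v : seq 'I_m) = m.+1 by rewrite /= size_tuple.
have [c cP] := cycle_lemma sz0v.
by rewrite -big_mkcond (big_pred1 c) => [|a]; [exact: w_shift | exact: cP].
Qed.

End Weights.

Theorem theorem5p1 (R : comNzRingType) (x y : R) (n : nat) (hn : (1 <= n)%N) :
  \sum_(t in PPF n) x ^+ unl (entries t) * y ^+ rep (entries t) =
  \prod_(1 <= i < n) (x * y + (i - 1)%:R * x + (n - 1 - i)%:R).
Proof.
case: n hn => [|[|m']] // _.
  (* For [n = 1] the circle would have no spots; the only prime parking function is [1]. *)
  rewrite big_geq // (big_pred1 [tuple 1]) ?mulr1 // => t.
  rewrite inE; case/tupleP: t => a t; rewrite (tuple0 t).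
  rewrite [RHS]/= -val_eqE /= eqseq_cons andbT.
  rewrite /prime_parking_function /parking_function /entries /= !andbT.
  rewrite andb_idr => [|_]; first by case: a => [[|[|]]].
  by apply/forallP => -[[|//] lti]; rewrite /= -ltnS.
pose h (u : m'.+2.-tuple 'I_m'.+1) : m'.+2.-tuple 'I_m'.+3 :=
  [tuple of [seq inord (val a).+1 | a <- u]].
pose h' (t : m'.+2.-tuple 'I_m'.+3) : m'.+2.-tuple 'I_m'.+1 :=
  [tuple of [seq inord (val a).-1 | a <- t]].
have entries_h u : entries (h u) = spots u.
  rewrite /entries /= -map_comp; apply: eq_map => a /=.
  by rewrite inordK // !ltnS ltnW.
have hK u : h' (h u) = u.
  apply: val_inj; rewrite /= -map_comp -[RHS]map_id; apply: eq_map => a /=.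
  by rewrite inordK /= ?inord_val // !ltnS ltnW.
have h'K t : t \in PPF m'.+2 -> h (h' t) = t.
  rewrite inE => /andP [/andP [/allP pos _] /allP Pt].
  apply: val_inj; rewrite /= -map_comp -[RHS]map_id; apply/eq_in_map => a ta /=.
  have et : size (entries t) = m'.+2 by rewrite size_map size_tuple.
  have a_gt0 : (0 < a)%N by apply: pos; apply: map_f.
  (* The prime condition at [j = n - 1] puts all [n] entries at most [n - 1], so they fit on the
     circle. *)
  have := Pt m'.+1; rewrite et mem_iota add1n ltnSn => /(_ isT) cnt.
  have : all (fun b => b <= m'.+1)%N (entries t).
    by rewrite all_count eqn_leq count_size et.
  move=> /allP /(_ _ (map_f val ta)) /= a_le.
  by apply: val_inj; rewrite /= !inordK; lia.
rewrite (reindex_onto h h') => [|t /h'K //].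
rewrite subn1 -sum_cprime; apply: eq_big => [u | u /andP []].
  by rewrite inE entries_h hK eqxx andbT prime_spots ?size_tuple.
rewrite inE entries_h prime_spots ?size_tuple // => Pu _.
by rewrite unl_spots ?size_tuple.
Qed.
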